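(* Let $q>1$ and $\omega>0$ be real, and let $\Gamma=2\omega$ (the critical case $\Gamma^2=4\omega^2$). Then the functions $$x_1(t)=e_q(-\omega t),\qquad x_2(t)=t\,\frac{d}{dt}\,e_q(-\omega t)$$ are linearly independent solutions of the $q$-damped oscillator equation $$D_q^2x(t)+\Gamma D_q x(t)+\omega^2x(t)=0 .$$
   Context: For real $q>1$, the Jackson $q$-derivative of a function $x$ is $D_q x(t)=\dfrac{x(qt)-x(t)}{(q-1)t}$ for $t\ne 0$; equations involving $D_q$ are understood for $t\neq 0$, and $D_q^2x=D_q(D_qx)$. The $q$-numbers are $[j]_q=1+q+\dots+q^{j-1}$, with $[j]_q!=[1]_q[2]_q\cdots[j]_q$ and $[0]_q!=1$. The Jackson $q$-exponential is $e_q(t)=\sum_{j=0}^\infty \dfrac{t^j}{[j]_q!}$, which is an entire function for $q>1$. In $x_2$ the ordinary derivative $d/dt$ is applied to the function $t\mapsto e_q(-\omega t)$. *)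

(* Defs.v *)
From Stdlib Require Import Reals.
From Coquelicot Require Import Coquelicot.
Open Scope R_scope.

(* The value at t = 0 is meaningless (division by zero); [Dq] is only ever
   constrained at nonzero points, and for t <> 0 and q > 1 the iterate
   [Dq q (Dq q x) t] samples [Dq q x] only at the nonzero points t and q * t. *)
Definition Dq (q : R) (x : R -> R) (t : R) : R :=
  (x (q * t) - x t) / ((q - 1) * t).

(* [j]_q = 1 + q + ... + q^(j-1), with the empty sum for j = 0. *)
Fixpoint qnum (q : R) (j : nat) : R :=
  match j with
  | O => 0
  | S i => qnum q i + q ^ i
  end.

Fixpoint qfact (q : R) (j : nat) : R :=
  match j with
  | O => 1
  | S i => qfact q i * qnum q (S i)
  end.

(* For q > 1 the radius of convergence is infinite, so [PSeries] is the actual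
   sum at every t. *)
Definition q_exp (q t : R) : R := PSeries (fun j => / qfact q j) t.

Definition q_damped_solution (q Gamma omega : R) (x : R -> R) : Prop :=
  forall t : R, t <> 0 ->
    Dq q (Dq q x) t + Gamma * Dq q x t + omega ^ 2 * x t = 0.

(* Independence over the constants of the restrictions of f and g to t <> 0,
   the domain of the q-difference equation; it implies independence on R. *)
Definition linearly_independent (f g : R -> R) : Prop :=
  forall a b : R,
    (forall t : R, t <> 0 -> a * f t + b * g t = 0) -> a = 0 /\ b = 0.

(* Main.v *)
Require Import Defs.
From Stdlib Require Import Reals Lra.
From Coquelicot Require Import Coquelicot.
Open Scope R_scope.

(** For [Gamma = 2 * omega] the operator of the equation is the square of
    [Dq + omega], and the two solutions form a Jordan chain for it:
    [(Dq + omega) x1 = 0] and [(Dq + omega) x2 = - omega * x1].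

    The first relation is the eigenvalue property of the [q]-exponential, read
    off its coefficients; cleared of denominators it is the dilation equation
    [f (q * t) = (1 + (q - 1) * (c * t)) * f t] with [f = x1], [c = - omega]
    ([q_exp_scaled_dilation]).  The Euler operator [t * d/dt] commutes with
    dilations, so applying it to this equation reproduces the same equation for
    [t * f' t], up to the term coming from the factor [1 + (q - 1) * (c * t)]
    ([Euler_dilation]); that term is the second relation.

    Independence follows by comparing a vanishing combination at [t] and at
    [q * t]: the chain isolates the coefficient of [x2] times [x1 t], and [x1]
    does not vanish at negative [t], where all terms of its series are
    positive. *)

(** * The q-exponential series *)

Lemma qnum_ge_INR (q : R) (j : nat) : 1 < q -> INR j <= qnum q j.
Proof.
  intros Hq; induction j as [|j IH].
  - simpl; lra.
  - rewrite S_INR; simpl.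
    assert (H := pow_R1_Rle q j (Rlt_le _ _ Hq)); lra.
Qed.

Lemma qnum_S_pos (q : R) (j : nat) : 1 < q -> 0 < qnum q (S j).
Proof.
  intros Hq; apply Rlt_le_trans with (INR (S j)).
  - apply lt_0_INR, Nat.lt_0_succ.
  - now apply qnum_ge_INR.
Qed.

Lemma qfact_pos (q : R) (j : nat) : 1 < q -> 0 < qfact q j.
Proof.
  intros Hq; induction j as [|j IH].
  - simpl; lra.
  - change (0 < qfact q j * qnum q (S j)).
    apply Rmult_lt_0_compat; [exact IH | now apply qnum_S_pos].
Qed.

Lemma qnum_geometric (q : R) (j : nat) : (q - 1) * qnum q j = q ^ j - 1.
Proof.
  induction j as [|j IH]; simpl.
  - ring.
  - rewrite Rmult_plus_distr_l, IH; ring.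
Qed.

(** The ratio [/ [j + 1]_q] of consecutive coefficients is at most
    [/ (j + 1)]. *)
Lemma CV_radius_q_exp (q : R) :
  1 < q -> CV_radius (fun j => / qfact q j) = p_infty.
Proof.
  intros Hq.
  apply CV_radius_infinite_DAlembert.
  - intros j; apply Rinv_neq_0_compat, Rgt_not_eq, qfact_pos, Hq.
  - apply is_lim_seq_le_le with (u := fun _ => 0) (w := fun j => / INR (S j)).
    + intros j.
      assert (Hf := qfact_pos q j Hq); assert (Hn := qnum_S_pos q j Hq).
      replace (/ qfact q (S j) / / qfact q j) with (/ qnum q (S j))
        by (simpl in *; field; lra).
      rewrite Rabs_pos_eq by (left; now apply Rinv_0_lt_compat).
      split.
      * left; now apply Rinv_0_lt_compat.
      * apply Rinv_le_contravar.
        -- apply lt_0_INR, Nat.lt_0_succ.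
        -- now apply qnum_ge_INR.
    + apply is_lim_seq_const.
    + replace (Finite 0) with (Rbar_inv p_infty) by reflexivity.
      apply is_lim_seq_inv; [| discriminate].
      apply -> is_lim_seq_incr_1; apply is_lim_seq_INR.
Qed.

Lemma is_pseries_q_exp (q t : R) :
  1 < q -> is_pseries (fun j => / qfact q j) t (q_exp q t).
Proof.
  intros Hq; apply PSeries_correct, CV_radius_inside.
  now rewrite CV_radius_q_exp.
Qed.

Lemma ex_derive_q_exp (q t : R) : 1 < q -> ex_derive (q_exp q) t.
Proof.
  intros Hq; eexists; apply is_derive_PSeries.
  now rewrite CV_radius_q_exp.
Qed.

Lemma q_exp_pos (q t : R) : 1 < q -> 0 <= t -> 0 < q_exp q t.
Proof.
  intros Hq Ht; unfold q_exp.
  rewrite PSeries_decr_1 by (eexists; now apply is_pseries_q_exp).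
  assert (Htail : 0 <= PSeries (PS_decr_1 (fun j => / qfact q j)) t).
  { rewrite <- (PSeries_const_0 t); unfold PSeries.
    apply Series_le.
    - intros j; rewrite Rmult_0_l; split; [lra |].
      apply Rmult_le_pos; [| now apply pow_le].
      left; apply Rinv_0_lt_compat, qfact_pos, Hq.
    - apply ex_pseries_R, ex_pseries_decr_1.
      + destruct (Req_dec t 0) as [-> | H0]; [now left | right].
        exists (/ t); now apply Rinv_l.
      + eexists; now apply is_pseries_q_exp. }
  simpl qfact at 1.
  assert (0 <= t * PSeries (PS_decr_1 (fun j => / qfact q j)) t)
    by now apply Rmult_le_pos.
  lra.
Qed.

(** This is [Dq q (q_exp q) = q_exp q] without denominators: the coefficients
    [a j = / [j]_q!] satisfy [(q ^ j - 1) * a j = (q - 1) * a (j - 1)]. *)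
Lemma q_exp_dilation (q t : R) :
  1 < q -> q_exp q (q * t) = (1 + (q - 1) * t) * q_exp q t.
Proof.
  intros Hq.
  assert (H1 := is_pseries_q_exp q t Hq).
  assert (H2 := is_pseries_q_exp q (q * t) Hq).
  assert (H3 := is_pseries_scal (q - 1) _ _ _ (Rmult_comm _ _)
                  (is_pseries_incr_1 _ _ _ H1)).
  assert (H4 := is_pseries_plus _ _ _ _ _ H1 H3).
  apply is_pseries_R, is_series_unique in H2.
  apply is_pseries_R, is_series_unique in H4.
  transitivity (q_exp q t + (q - 1) * (t * q_exp q t)).
  - rewrite <- H2; etransitivity; [| exact H4].
    apply Series_ext; intros [|j].
    + change (/ 1 * 1 = (/ 1 + (q - 1) * 0) * 1); ring.
    + change (/ qfact q (S j) * (q * t) ^ S j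
              = (/ qfact q (S j) + (q - 1) * / qfact q j) * t ^ S j).
      rewrite Rpow_mult_distr.
      replace (q ^ S j) with (1 + (q - 1) * qnum q (S j))
        by (rewrite qnum_geometric; ring).
      change (qfact q (S j)) with (qfact q j * qnum q (S j)).
      assert (Hf := qfact_pos q j Hq); assert (Hn := qnum_S_pos q j Hq).
      field; lra.
  - ring.
Qed.

Lemma q_exp_scaled_dilation (q c t : R) :
  1 < q ->
  q_exp q (c * (q * t)) = (1 + (q - 1) * (c * t)) * q_exp q (c * t).
Proof.
  intros Hq; rewrite <- q_exp_dilation by exact Hq.
  f_equal; ring.
Qed.

(** * The Jordan chain *)

Lemma Euler_dilation (q c : R) (f : R -> R) :
  (forall t, ex_derive f t) ->
  (forall t, f (q * t) = (1 + (q - 1) * (c * t)) * f t) ->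
  forall t,
    q * t * Derive f (q * t)
    = (1 + (q - 1) * (c * t)) * (t * Derive f t) + (q - 1) * (c * t) * f t.
Proof.
  intros Hd Hf t.
  assert (HL : is_derive (fun s => f (q * s)) t (q * Derive f (q * t))).
  { auto_derive; [apply Hd |].
    change (Derive (fun x => f x) (q * t)) with (Derive f (q * t)); ring. }
  assert (HR : is_derive (fun s => (1 + (q - 1) * (c * s)) * f s) t
                 ((q - 1) * c * f t + (1 + (q - 1) * (c * t)) * Derive f t)).
  { auto_derive; [apply Hd |].
    change (Derive (fun x => f x) t) with (Derive f t); ring. }
  apply (is_derive_ext _ _ _ _ Hf) in HL.
  apply is_derive_unique in HL; apply is_derive_unique in HR.
  replace (q * t * Derive f (q * t)) with (t * (q * Derive f (q * t))) by ring.
  rewrite <- HL; etransitivity; [apply f_equal, HR | ring].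
Qed.

(** The hypotheses are the dilation forms of [(Dq + omega) f = 0] and
    [(Dq + omega) g = e * f], so that [(Dq + omega) ^ 2 g = 0]; the choice [e = 0], [g = f] gives the eigenfunction itself. *)
Lemma generalized_eigenfunction_solution (q omega e : R) (f g : R -> R) :
  1 < q ->
  (forall t, f (q * t) = (1 + (q - 1) * (- omega * t)) * f t) ->
  (forall t, g (q * t)
             = (1 + (q - 1) * (- omega * t)) * g t + (q - 1) * (e * t) * f t) ->
  q_damped_solution q (2 * omega) omega g.
Proof.
  intros Hq Hf Hg t Ht; unfold Dq.
  rewrite !Hg, !Hf.
  field; repeat split; lra.
Qed.

Theorem mainTheorem2 :
  forall q omega Gamma : R,
    1 < q -> 0 < omega -> Gamma = 2 * omega ->
    let x1 := fun t : R => q_exp q (- omega * t) in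
    let x2 := fun t : R => t * Derive (fun s : R => q_exp q (- omega * s)) t in
    q_damped_solution q Gamma omega x1 /\
    q_damped_solution q Gamma omega x2 /\
    linearly_independent x1 x2.
Proof.
  intros q omega Gamma Hq Ho -> x1 x2.
  assert (H1 : forall t, x1 (q * t) = (1 + (q - 1) * (- omega * t)) * x1 t)
    by (intros t; now apply q_exp_scaled_dilation).
  assert (H2 : forall t, x2 (q * t)
                 = (1 + (q - 1) * (- omega * t)) * x2 t
                   + (q - 1) * (- omega * t) * x1 t).
  { apply (Euler_dilation q (- omega) x1); [| exact H1].
    intros t; unfold x1; apply (ex_derive_comp (q_exp q)).
    - now apply ex_derive_q_exp.
    - auto_derive; exact I. }
  split; [| split].
  - apply generalized_eigenfunction_solution with (e := 0) (f := x1);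
      [exact Hq | exact H1 | intros t; rewrite H1; ring].
  - now apply generalized_eigenfunction_solution with (e := - omega) (f := x1).
  - intros a b Hab.
    assert (Hpos : 0 < x1 (-1)) by (apply q_exp_pos; lra).
    assert (E1 := Hab (-1) ltac:(lra)).
    assert (E2 := Hab (q * -1) ltac:(lra)).
    rewrite H1, H2 in E2.
    (* The relation at [- q] minus [1 + (q - 1) * omega] times the one at [-1]
       leaves only the term that the chain adds to [x2]. *)
    assert (Hb : b * ((q - 1) * omega * x1 (-1)) = 0).
    { transitivity ((1 + (q - 1) * omega) * (a * x1 (-1) + b * x2 (-1))
                    + b * ((q - 1) * omega * x1 (-1))).
      - rewrite E1; ring.
      - rewrite <- E2; ring. }
    assert (Hc : 0 < (q - 1) * omega * x1 (-1))
      by (repeat apply Rmult_lt_0_compat; lra).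
    apply Rmult_integral in Hb; destruct Hb as [-> | Hb]; [| lra].
    split; [| reflexivity].
    assert (Ha : a * x1 (-1) = 0) by lra.
    apply Rmult_integral in Ha; destruct Ha; [assumption | lra].
Qed.
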